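(* Let $(\mathfrak g,[\cdot,\cdot,\cdot]_{\mathfrak g})$ be a finite-dimensional real $3$-Lie algebra. Then the following statements are equivalent: (i) $\mathfrak g$ has a complex product structure; (ii) $\mathfrak g$ has a complex structure $J$ and can be decomposed as $\mathfrak g=\mathfrak g_+\oplus\mathfrak g_-$ (direct sum of vector spaces), where $\mathfrak g_+,\mathfrak g_-$ are $3$-Lie subalgebras of $\mathfrak g$ and $\mathfrak g_-=J\mathfrak g_+$.
   Context: A $3$-Lie algebra is a vector space $\mathfrak g$ with a trilinear skew-symmetric bracket $[\cdot,\cdot,\cdot]_{\mathfrak g}$ (written $[\cdot,\cdot,\cdot]$ below) satisfying $[x,y,[z,w,v]]=[[x,y,z],w,v]+[z,[x,y,w],v]+[z,w,[x,y,v]]$ for all $x,y,z,w,v\in\mathfrak g$. A product structure on $\mathfrak g$ is a linear map $E:\mathfrak g\to\mathfrak g$ with $E^2=\mathrm{Id}$, $E\neq\pm\mathrm{Id}$, such that for all $x,y,z\in\mathfrak g$: $E[x,y,z]=[Ex,Ey,Ez]+[Ex,y,z]+[x,Ey,z]+[x,y,Ez]-E[Ex,Ey,z]-E[x,Ey,Ez]-E[Ex,y,Ez]$. A complex structure on a real $3$-Lie algebra $\mathfrak g$ is a linear map $J:\mathfrak g\to\mathfrak g$ with $J^2=-\mathrm{Id}$ such that for all $x,y,z\in\mathfrak g$: $J[x,y,z]=-[Jx,Jy,Jz]+[Jx,y,z]+[x,Jy,z]+[x,y,Jz]+J[Jx,Jy,z]+J[x,Jy,Jz]+J[Jx,y,Jz]$.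 A complex product structure on a real $3$-Lie algebra $\mathfrak g$ is a pair $\{J,E\}$ of a complex structure $J$ and a product structure $E$ with $J\circ E=-E\circ J$.
   Formalization: The 3-Lie algebra is assumed to be nonzero: for the zero algebra, (ii) holds with J = 0 and both summands zero, while (i) fails because the only linear map equals both Id and −Id, so no product structure exists. *)

(* Defs.v *)
From HB Require Import structures.
From mathcomp Require Import all_boot all_order all_algebra.
From mathcomp Require Import reals.

Set Implicit Arguments.
Unset Strict Implicit.
Unset Printing Implicit Defensive.

Import GRing.Theory.
Local Open Scope ring_scope.

(* Finite-dimensional 3-Lie algebras over a field.  The two skew-symmetry
   axioms are for adjacent transpositions, which generate 'S_3. *)
HB.mixin Record Vector_isLie3 (K : fieldType) g of Vector K g := {
  br3 : g -> g -> g -> g;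
  br3_linear1 : forall y z, linear (fun x => br3 x y z);
  br3_linear2 : forall x z, linear (fun y => br3 x y z);
  br3_linear3 : forall x y, linear (fun z => br3 x y z);
  br3_skew12 : forall x y z, br3 y x z = - br3 x y z;
  br3_skew23 : forall x y z, br3 x z y = - br3 x y z;
  br3_fundamental : forall x y z w v,
    br3 x y (br3 z w v) =
      br3 (br3 x y z) w v + br3 z (br3 x y w) v + br3 z w (br3 x y v)
}.

#[short(type="lie3Type")]
HB.structure Definition Lie3 (K : fieldType) :=
  { g of Vector K g & Vector_isLie3 K g }.

Definition subalgebra3 (K : fieldType) (g : lie3Type K) (h : {vspace g}) :=
  forall x y z : g, x \in h -> y \in h -> z \in h -> br3 x y z \in h.

Definition product_structure (K : fieldType) (g : lie3Type K) (E : 'End(g)) :=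
  [/\ (E \o E)%VF = \1%VF, E <> \1%VF, E <> - \1%VF
    & forall x y z : g,
        E (br3 x y z) =
          br3 (E x) (E y) (E z)
          + br3 (E x) y z + br3 x (E y) z + br3 x y (E z)
          - E (br3 (E x) (E y) z) - E (br3 x (E y) (E z))
          - E (br3 (E x) y (E z))].

Definition complex_structure (R : realType) (g : lie3Type R) (J : 'End(g)) :=
  (J \o J)%VF = - \1%VF /\
  forall x y z : g,
    J (br3 x y z) =
      - br3 (J x) (J y) (J z)
      + br3 (J x) y z + br3 x (J y) z + br3 x y (J z)
      + J (br3 (J x) (J y) z) + J (br3 x (J y) (J z))
      + J (br3 (J x) y (J z)).

Definition complex_product_structure (R : realType) (g : lie3Type R)
    (J E : 'End(g)) :=
  [/\ complex_structure J, product_structure E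
    & (J \o E)%VF = - (E \o J)%VF].

(* Main.v *)
Require Import Defs.
From HB Require Import structures.
From mathcomp Require Import all_boot all_order all_algebra.
From mathcomp Require Import reals.
From mathcomp Require Import ring.

Set Implicit Arguments.
Unset Strict Implicit.
Unset Printing Implicit Defensive.

Import GRing.Theory passmx.
Local Open Scope ring_scope.

(** A linear involution [E] is the same datum as the splitting of the space
    into its eigenspaces for [1] and [-1], and the theorem says that under this
    dictionary the two kinds of conditions on [E] match.

    Integrability.  The defect of the product identity is trilinear, so it is
    determined by its values on eigenvectors.  On eigenvectors for [a], [b],
    [c], with [u] their bracket, it is
    [(1 + ab + bc + ac) E u - (abc + a + b + c) u] ([product_defect_eigen]).
    If [a], [b], [c] are all the same sign [e], this is [4 (E u - e u)], which,
    as 2 is invertible, vanishes exactly when [u] is again an eigenvector for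
    [e]: the two eigenspaces are subalgebras.  If the signs are not all equal, both
    coefficients are zero, so mixed brackets impose no condition.

    Compatibility with [J].  If [J E = - E J], then [J] exchanges the two
    eigenspaces.  Conversely, if [J] maps [gp] onto [gm], it maps [gm] back
    onto [gp] because [J^2 = -1], and then [J] anticommutes with the involution
    that is [1] on [gp] and [-1] on [gm].  That involution is neither [1] nor
    [-1]: otherwise one of [gp], [gm] is zero, hence both are, since [J] maps
    each of them onto the other, and the whole space would be zero. *)

(** * Trilinearity of the bracket *)

(** The bracket is linear in each argument in the sense of an unbundled
    predicate on functions of that argument, which these two lemmas turn into
    rewriting rules. *)
Section LinearPredicate.
Variables (K : pzRingType) (U V : lmodType K) (f : U -> V).
Hypothesis f_linear : linear f.

Lemma linear_pred_add x y : f (x + y) = f x + f y.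
Proof. by have := f_linear 1 x y; rewrite !scale1r. Qed.

Lemma linear_pred_scale a x : f (a *: x) = a *: f x.
Proof.
have f0 : f 0 = 0.
  by apply: (addIr (f 0)); rewrite -linear_pred_add !add0r.
by have := f_linear a x 0; rewrite f0 !addr0.
Qed.

End LinearPredicate.

Section Bracket.
Variables (K : fieldType) (g : lie3Type K).
Implicit Types (x y z : g) (a : K).

Lemma br3D1 x x' y z : br3 (x + x') y z = br3 x y z + br3 x' y z.
Proof. exact: (linear_pred_add (br3_linear1 y z)). Qed.

Lemma br3D2 x y y' z : br3 x (y + y') z = br3 x y z + br3 x y' z.
Proof. exact: (linear_pred_add (br3_linear2 x z)). Qed.

Lemma br3D3 x y z z' : br3 x y (z + z') = br3 x y z + br3 x y z'.
Proof. exact: (linear_pred_add (br3_linear3 x y)). Qed.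

Lemma br3Z1 a x y z : br3 (a *: x) y z = a *: br3 x y z.
Proof. exact: (linear_pred_scale (br3_linear1 y z)). Qed.

Lemma br3Z2 a x y z : br3 x (a *: y) z = a *: br3 x y z.
Proof. exact: (linear_pred_scale (br3_linear2 x z)). Qed.

Lemma br3Z3 a x y z : br3 x y (a *: z) = a *: br3 x y z.
Proof. exact: (linear_pred_scale (br3_linear3 x y)). Qed.

End Bracket.

(** * The defect of the product identity *)

Section Defect.
Variables (K : fieldType) (g : lie3Type K) (E : 'End(g)).
Implicit Types (x y z : g) (a b c : K).

(** All terms are on one side and the signs are distributed, so that additivity
    in each variable is a mere permutation of summands. *)
Definition product_defect x y z : g :=
  E (br3 x y z) + E (br3 (E x) (E y) z) + E (br3 x (E y) (E z))
  + E (br3 (E x) y (E z))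
  - br3 (E x) (E y) (E z) - br3 (E x) y z - br3 x (E y) z - br3 x y (E z).

Lemma product_defect_eq0 x y z :
  product_defect x y z = 0 <->
  E (br3 x y z) =
    br3 (E x) (E y) (E z)
    + br3 (E x) y z + br3 x (E y) z + br3 x y (E z)
    - E (br3 (E x) (E y) z) - E (br3 x (E y) (E z))
    - E (br3 (E x) y (E z)).
Proof.
rewrite /product_defect; set rhs := (X in _ <-> _ = X).
rewrite [X in X = 0](_ : _ = E (br3 x y z) - rhs).
  by split=> [/subr0_eq|->]; rewrite ?subrr.
by rewrite /rhs !opprD !opprK !addrA [RHS](ACl (1*6*7*8*2*3*4*5)).
Qed.

Lemma product_defectD1 x x' y z :
  product_defect (x + x') y z = product_defect x y z + product_defect x' y z.
Proof.
rewrite /product_defect !(linearD, br3D1) !addrA.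
by rewrite [LHS](ACl (1*3*5*7*9*11*13*15*2*4*6*8*10*12*14*16)).
Qed.

Lemma product_defectD2 x y y' z :
  product_defect x (y + y') z = product_defect x y z + product_defect x y' z.
Proof.
rewrite /product_defect !(linearD, br3D2) !addrA.
by rewrite [LHS](ACl (1*3*5*7*9*11*13*15*2*4*6*8*10*12*14*16)).
Qed.

Lemma product_defectD3 x y z z' :
  product_defect x y (z + z') = product_defect x y z + product_defect x y z'.
Proof.
rewrite /product_defect !(linearD, br3D3) !addrA.
by rewrite [LHS](ACl (1*3*5*7*9*11*13*15*2*4*6*8*10*12*14*16)).
Qed.

(** On eigenvectors each term is a multiple of [E u] or of [u], where [u] is the
    bracket of the three; the coefficients are symmetric functions of the
    eigenvalues. *)
Lemma product_defect_eigen a b c x y z :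
    E x = a *: x -> E y = b *: y -> E z = c *: z ->
  product_defect x y z =
    (1 + a * b + b * c + a * c) *: E (br3 x y z)
    - (a * b * c + a + b + c) *: br3 x y z.
Proof.
move=> Ex Ey Ez; rewrite /product_defect Ex Ey Ez.
rewrite !(br3Z1, br3Z2, br3Z3) !linearZ /= !scalerA !scalerDl scale1r.
by rewrite !addrA.
Qed.

(** The defect is trilinear, so homogeneous arguments suffice.  When all three
    lie in the same summand, closure under the bracket kills the defect; when
    the signs are mixed, both coefficients of [product_defect_eigen] are zero,
    wherever the bracket lies. *)
Lemma product_defect_involution (gp gm : {vspace g}) :
    (gp + gm)%VS = {:g}%VS -> subalgebra3 gp -> subalgebra3 gm ->
    {in gp, forall x, E x = x} -> {in gm, forall x, E x = - x} ->
  forall x y z, product_defect x y z = 0.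
Proof.
move=> gpm sub_p sub_m Ep Em.
have defect_span (P : g -> Prop) : (forall x y, P x -> P y -> P (x + y)) ->
    {in gp, forall x, P x} -> {in gm, forall x, P x} -> forall x, P x.
  move=> PD Pp Pm x; have: x \in (gp + gm)%VS by rewrite gpm memvf.
  by case/memv_addP=> u up [v vm ->]; apply: PD; [apply: Pp | apply: Pm].
have Ep1 x : x \in gp -> E x = 1 *: x by rewrite scale1r; apply: Ep.
have Em1 x : x \in gm -> E x = (- 1) *: x by rewrite scaleN1r; apply: Em.
have mixed a b c x y z : E x = a *: x -> E y = b *: y -> E z = c *: z ->
    1 + a * b + b * c + a * c = 0 -> a * b * c + a + b + c = 0 ->
    product_defect x y z = 0.
  move=> Ex Ey Ez e1 e2.
  by rewrite (product_defect_eigen Ex Ey Ez) e1 e2 !scale0r subr0.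
have pure a x y z : E x = a *: x -> E y = a *: y -> E z = a *: z ->
    E (br3 x y z) = a *: br3 x y z -> a ^+ 2 = 1 -> product_defect x y z = 0.
  move=> Ex Ey Ez Eu a2; rewrite (product_defect_eigen Ex Ey Ez) Eu scalerA.
  rewrite -scalerBl (_ : _ - _ = 2%:R * a * (a ^+ 2 - 1)); last by ring.
  by rewrite a2 subrr mulr0 scale0r.
move=> x y z; elim/defect_span: x => [x x' hx hx'|x xp|x xm].
- by rewrite product_defectD1 hx hx' addr0.
- elim/defect_span: y => [y y' hy hy'|y yp|y ym].
  + by rewrite product_defectD2 hy hy' addr0.
  + elim/defect_span: z => [z z' hz hz'|z zp|z zm].
    * by rewrite product_defectD3 hz hz' addr0.
    * by apply: (@pure 1); rewrite ?expr1n //; apply: Ep1 => //; apply: sub_p.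
    * by apply: (mixed _ _ _ _ _ _ (Ep1 _ xp) (Ep1 _ yp) (Em1 _ zm)); ring.
  + elim/defect_span: z => [z z' hz hz'|z zp|z zm].
    * by rewrite product_defectD3 hz hz' addr0.
    * by apply: (mixed _ _ _ _ _ _ (Ep1 _ xp) (Em1 _ ym) (Ep1 _ zp)); ring.
    * by apply: (mixed _ _ _ _ _ _ (Ep1 _ xp) (Em1 _ ym) (Em1 _ zm)); ring.
- elim/defect_span: y => [y y' hy hy'|y yp|y ym].
  + by rewrite product_defectD2 hy hy' addr0.
  + elim/defect_span: z => [z z' hz hz'|z zp|z zm].
    * by rewrite product_defectD3 hz hz' addr0.
    * by apply: (mixed _ _ _ _ _ _ (Em1 _ xm) (Ep1 _ yp) (Ep1 _ zp)); ring.
    * by apply: (mixed _ _ _ _ _ _ (Em1 _ xm) (Ep1 _ yp) (Em1 _ zm)); ring.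
  + elim/defect_span: z => [z z' hz hz'|z zp|z zm].
    * by rewrite product_defectD3 hz hz' addr0.
    * by apply: (mixed _ _ _ _ _ _ (Em1 _ xm) (Em1 _ ym) (Ep1 _ zp)); ring.
    * apply: (@pure (- 1)); rewrite ?sqrrN ?expr1n //; apply: Em1 => //.
      exact: sub_m.
Qed.

End Defect.

(** * From an involution to its eigenspaces *)

Section Eigenspaces.
Variables (K : fieldType) (V : vectType K).

Lemma mem_leigenspace (f : 'End(V)) a v :
  (v \in leigenspace f a) = (f v == a *: v).
Proof. by rewrite memv_ker !lfun_simp subr_eq0. Qed.

(** Each vector is [x = (x + E x) / 2 + (x - E x) / 2]. *)
Lemma involution_addv_eigenspaces (E : 'End(V)) :
    2%:R != 0 :> K -> (E \o E)%VF = \1%VF ->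
  (leigenspace E 1 + leigenspace E (- 1))%VS = {:V}%VS.
Proof.
move=> nz2 /lfunP EE; apply/vspaceP=> x; rewrite memvf.
have {}EE v : E (E v) = v by have := EE v; rewrite !lfun_simp.
have -> : x = 2%:R^-1 *: (x + E x) + 2%:R^-1 *: (x - E x).
  rewrite -scalerDr addrACA subrr addr0 -mulr2n -scaler_nat scalerA.
  by rewrite mulVf // scale1r.
apply: memv_add; rewrite mem_leigenspace linearZ /= ?scale1r ?scaleN1r.
  by rewrite raddfD /= EE addrC.
by rewrite raddfB /= EE -scalerN opprB.
Qed.

Lemma directv_eigenspaces (E : 'End(V)) :
  2%:R != 0 :> K -> directv (leigenspace E 1 + leigenspace E (- 1)).
Proof.
move=> nz2; apply/directv_addP/eqP; rewrite -subv0; apply/subvP=> x.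
rewrite memv_cap !mem_leigenspace memv0 => /andP[/eqP-> ].
by rewrite scale1r scaleN1r -subr_eq0 opprK -mulr2n -scaler_nat scaler_eq0
  (negPf nz2).
Qed.

(** [J] sends an [a]-eigenvector of [E] to a [-a]-eigenvector, and every
    [-a]-eigenvector [v] is reached, as [v = J (- J v)]. *)
Lemma limg_anticommuting_eigenspace (J E : 'End(V)) a :
    (J \o J)%VF = - \1%VF -> (J \o E)%VF = - (E \o J)%VF ->
  leigenspace E (- a) = (J @: leigenspace E a)%VS.
Proof.
move=> /lfunP JJ /lfunP JE.
have {}JJ v : J (J v) = - v by have := JJ v; rewrite !lfun_simp.
have {}JE v : E (J v) = - J (E v).
  by have := JE v; rewrite !lfun_simp => ->; rewrite opprK.
apply/vspaceP=> v; apply/idP/memv_imgP=> [|[u]].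
  rewrite mem_leigenspace => /eqP Ev; exists (- J v).
    rewrite mem_leigenspace linearN /= JE Ev linearZ /= scaleNr.
    by rewrite !opprK scalerN.
  by rewrite linearN /= JJ opprK.
by rewrite !mem_leigenspace => /eqP Eu ->; rewrite JE Eu linearZ /= scaleNr.
Qed.

End Eigenspaces.

(** With all three eigenvalues equal to [e], the defect is
    [4 (E u - e u)] for the bracket [u]. *)
Lemma subalgebra3_eigenspace (K : fieldType) (g : lie3Type K) (E : 'End(g))
    (e : K) :
    2%:R != 0 :> K -> e ^+ 2 = 1 ->
    (forall x y z : g, product_defect E x y z = 0) ->
  subalgebra3 (leigenspace E e).
Proof.
move=> nz2 e2 E0 x y z; rewrite !mem_leigenspace => /eqP Ex /eqP Ey /eqP Ez.
have /eqP := E0 x y z; rewrite (product_defect_eigen Ex Ey Ez) -!expr2 !e2.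
rewrite (_ : 1 + _ + _ + _ = 2%:R * 2%:R); last by ring.
rewrite (_ : 1 * e + _ + _ + _ = 2%:R * 2%:R * e); last by ring.
by rewrite -[X in _ - X]scalerA -scalerBr scaler_eq0 mulf_eq0 (negPf nz2)
  subr_eq0.
Qed.

(** * From a splitting to the involution *)

(** The involution is the projection onto [gp] minus the projection onto
    [gm]. *)
Lemma splitting_involution (K : fieldType) (V : vectType K)
    (gp gm : {vspace V}) :
    (gp + gm)%VS = {:V}%VS -> directv (gp + gm) ->
  exists E : 'End(V), [/\ {in gp, forall x, E x = x},
    {in gm, forall x, E x = - x} & (E \o E)%VF = \1%VF].
Proof.
move=> gpm /directv_addP dpm.
have dmp : (gm :&: gp = 0)%VS by rewrite capvC.
pose E : 'End(V) := daddv_pi gp gm - daddv_pi gm gp.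
have pi_add x : daddv_pi gp gm x + daddv_pi gm gp x = x.
  by rewrite daddv_pi_add // gpm memvf.
have Ep : {in gp, forall x, E x = x}.
  move=> x xp; rewrite /E !lfun_simp daddv_pi_id //.
  have /eqP := pi_add x; rewrite daddv_pi_id // -[X in _ == X]addr0.
  by rewrite (inj_eq (addrI _)) => /eqP->; rewrite subr0.
have Em : {in gm, forall x, E x = - x}.
  move=> x xm; rewrite /E !lfun_simp [daddv_pi gm gp x]daddv_pi_id //.
  have /eqP := pi_add x; rewrite [daddv_pi gm gp x]daddv_pi_id //.
  by rewrite -[X in _ == X]add0r (inj_eq (addIr _)) => /eqP->; rewrite add0r.
exists E; split=> //; apply/lfunP=> x; rewrite comp_lfunE id_lfunE.
rewrite -(pi_add x) !raddfD /= (Ep _ (memv_pi _ _ _)).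
by rewrite (Em _ (memv_pi _ _ _)) raddfN /= Ep ?Em ?opprK ?memv_pi.
Qed.

Theorem theorem7p5 (R : realType) (g : lie3Type R)
    (g_neq0 : {:g}%VS <> 0%VS) :
  (exists J E : 'End(g), complex_product_structure J E)
  <->
  (exists J : 'End(g), complex_structure J /\
     exists gp gm : {vspace g},
       [/\ (gp + gm)%VS = {:g}%VS, directv (gp + gm),
           subalgebra3 gp, subalgebra3 gm & gm = (J @: gp)%VS]).
Proof.
split=> [[J [E [Jc [EE _ _ Eint] JE]]]|[J [[JJ Jint] [gp [gm]]]]].
  have nz2 : 2%:R != 0 :> R by rewrite Num.Theory.pnatr_eq0.
  have E0 x y z : product_defect E x y z = 0 by apply/product_defect_eq0.
  exists J; split=> //; exists (leigenspace E 1), (leigenspace E (- 1)); split.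
  - exact: involution_addv_eigenspaces.
  - exact: directv_eigenspaces.
  - by apply: subalgebra3_eigenspace; rewrite ?expr1n.
  - by apply: subalgebra3_eigenspace; rewrite ?sqrrN ?expr1n.
  - by case: Jc => JJ _; apply: limg_anticommuting_eigenspace.
move=> [gpm dpm sub_p sub_m gmE].
have [E [Ep Em EE]] := splitting_involution gpm dpm.
have JJx v : J (J v) = - v by have /lfunP/(_ v) := JJ; rewrite !lfun_simp.
have Jp v : v \in gp -> J v \in gm by rewrite gmE; apply: memv_img.
have Jm v : v \in gm -> J v \in gp.
  by rewrite gmE => /memv_imgP[u up ->]; rewrite JJx memvN.
have splitE x : exists u v, [/\ u \in gp, v \in gm & x = u + v].
  have: x \in (gp + gm)%VS by rewrite gpm memvf.
  by case/memv_addP=> u up [v vm ->]; exists u, v.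
have nz2 (v : g) : v = - v -> v = 0.
  move/eqP; rewrite -subr_eq0 opprK -mulr2n -scaler_nat scaler_eq0.
  by rewrite Num.Theory.pnatr_eq0 => /eqP.
have J0 v : J v = 0 -> v = 0.
  by move=> Jv; apply/eqP; rewrite -oppr_eq0 -JJx Jv linear0.
have full0 : ~ forall x : g, x = 0.
  by move=> g0; apply: g_neq0; apply/vspaceP=> x; rewrite (g0 x) !mem0v.
exists J, E; split=> //; last first.
  apply/lfunP=> x; have [u [v [up vm ->]]] := splitE x.
  rewrite !lfun_simp !linearD /= Ep // Em // linearN /=.
  by rewrite (Em _ (Jp _ up)) (Ep _ (Jm _ vm)) opprK.
split=> //.
- (* [E = 1] fixes [gm], on which it is also [-1], so [gm = 0];
     then [gp = 0] as [J] maps it into [gm]. *)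
  move=> E1; have gm0 v : v \in gm -> v = 0.
    by move=> vm; apply: nz2; rewrite -Em // E1 id_lfunE.
  apply: full0 => x; have [u [v [up vm ->]]] := splitE x.
  by rewrite (gm0 v vm) (J0 u) ?addr0 //; apply/gm0/Jp.
- move=> E1; have gp0 v : v \in gp -> v = 0.
    by move=> vp; apply: nz2; rewrite -[LHS](Ep v vp) E1 !lfun_simp.
  apply: full0 => x; have [u [v [up vm ->]]] := splitE x.
  by rewrite (gp0 u up) (J0 v) ?addr0 //; apply/gp0/Jm.
- move=> x y z; apply/product_defect_eq0.
  exact: (product_defect_involution gpm).
Qed.
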